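(* Let $V: L^1([0,1])\to C([0,1])$ be the Volterra operator, $V(f)(x)=\int_0^x f(t)\,dt$ for $f\in L^1([0,1])$ and $x\in[0,1]$. Then $$\|V\|_e= \|V\|_{e,w}= \frac{1}{2}.$$
   Context: $L^1([0,1])$ is taken with respect to Lebesgue measure, and $C([0,1])$ carries the supremum norm. For a bounded operator $T:X\to Y$ between Banach spaces, $\|T\|_{e}=\inf\{\|T-S\|: S:X\to Y \text{ compact}\}$ and $\|T\|_{e,w}=\inf\{\|T-S\|: S:X\to Y \text{ weakly compact}\}$, where an operator is weakly compact if the image of the unit ball is relatively weakly compact. *)

(* Defs.v *)
From HB Require Import structures.
From mathcomp Require Import all_boot all_order all_algebra.
From mathcomp Require Import all_classical all_reals all_analysis.
From mathcomp Require Import ess_sup_inf measurable_realfun lebesgue_measure.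
From mathcomp Require Import lebesgue_integral hoelder ftc.

Set Implicit Arguments.
Unset Strict Implicit.
Unset Printing Implicit Defensive.
Import Order.TTheory GRing.Theory Num.Theory.
Import numFieldNormedType.Exports.

Local Open Scope classical_set_scope.
Local Open Scope ring_scope.

Section EssentialNorms.
Variable R : realType.

(* The coarsest topology making every norm-continuous linear functional on
   [Y] continuous. *)
Definition weak_topology (Y : normedModType R) : Type :=
  sup_topology (fun phi : {phi : {linear Y -> R^o} | continuous phi} =>
    Topological.class (initial_topology (sval phi : Y -> R^o))).

HB.instance Definition _ (Y : normedModType R) :=
  Topological.copy (weak_topology Y)
    (sup_topology (fun phi : {phi : {linear Y -> R^o} | continuous phi} =>
      Topological.class (initial_topology (sval phi : Y -> R^o)))).

Variables X Y : normedModType R.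

Definition unit_ball : set X := [set x | `|x| <= 1].

(* Meaningful for bounded [T] only: [sup] of an unbounded set is a junk
   value. *)
Definition opnorm (T : X -> Y) : R := sup [set `|T x| | x in unit_ball].

Definition compact_operator (S : {linear X -> Y}) : Prop :=
  continuous S /\ precompact (S @` unit_ball).

Definition weakly_compact_operator (S : {linear X -> Y}) : Prop :=
  continuous S /\ precompact (S @` unit_ball : set (weak_topology Y)).

Definition ess_norm (T : {linear X -> Y}) : R :=
  inf [set opnorm (T \- S) | S in compact_operator].

Definition weak_ess_norm (T : {linear X -> Y}) : R :=
  inf [set opnorm (T \- S) | S in weakly_compact_operator].

End EssentialNorms.

(* [LspaceType mu p1] is the library's type of a.e.-classes of p-integrable
   functions, which comes without algebraic structure: here it is made a
   normed module, with operations computed on representatives. *)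
Section LspaceNormed.
Context d (T : measurableType d) (R : realType).
Variables (mu : {measure set T -> \bar R}) (p : \bar R) (p1 : (1 <= p)%E).
Local Notation F := (LfunType mu p1).
Local Notation L := (LspaceType mu p1).

HB.instance Definition _ := gen_eqMixin L.
HB.instance Definition _ := gen_choiceMixin L.

Lemma Lnorm_ae_eq (f g : {mfun T >-> R}) :
  f = g %[ae mu] -> ('N[mu]_p[EFin \o f] = 'N[mu]_p[EFin \o g])%E.
Proof.
move=> fg; rewrite unlock /Lnorm.
have fgT : \forall x \ae mu, f x = g x by apply: filterS fg => x /(_ I).
case: p p1 => [r r1|_|//].
- congr (_ `^ _)%E; apply: ae_eq_integral => //.
  + apply: (measurableT_comp (measurable_poweR _)).
    by apply: measurableT_comp => //; exact/measurable_EFinP.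
  + apply: (measurableT_comp (measurable_poweR _)).
    by apply: measurableT_comp => //; exact/measurable_EFinP.
  + by apply: filterS fgT => x /= ->.
- case: ifPn => // _; apply: eq_ess_sup.
  by apply: filterS fgT => x /= ->.
Qed.

(* [LspaceType] is built on functions valued in [measurableTypeR R], which
   carries the Borel sigma-algebra of [R] with another display; hence the
   repackaging below. *)
Let toTR (f : F) : {mfun T >-> measurableTypeR R} :=
  HB.pack (f : T -> measurableTypeR R)
    (isMeasurableFun.Build _ _ T (measurableTypeR R) f
      (@measurable_funPT _ _ _ _ f)).

Let ofTR (f : {mfun T >-> measurableTypeR R}) : {mfun T >-> R} :=
  HB.pack (f : T -> R)
    (isMeasurableFun.Build _ _ T R f (@measurable_funPT _ _ _ _ f)).

Let mcls (f : F) : {mfun_ mu, T >-> measurableTypeR R} := \pi%qT (toTR f).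

Lemma repr_mclsE (f : F) : (repr (mcls f) : T -> R) = f %[ae mu].
Proof.
apply/(@asboolP (ae_eq mu setT (repr (mcls f) : T -> R) f)).
suff : ae_eq_op mu (repr (mcls f)) (toTR f) by [].
by rewrite -eqmodE reprK.
Qed.

Lemma finite_norm_mcls (f : F) : finite_norm mu p (mcls f : T -> R).
Proof.
rewrite /finite_norm (@Lnorm_ae_eq (ofTR (repr (mcls f))) f).
  exact: Lfunction_finite.
exact: repr_mclsE.
Qed.

Definition Lclass (f : F) : L :=
  HB.pack (mcls f) (isFinLebesgue.Build d T R mu p p1 _ (finite_norm_mcls f)).

Definition Lrepr (x : L) : F :=
  HB.pack (ofTR (repr (x : {mfun_ mu, T >-> measurableTypeR R})) : T -> R)
    (isMeasurableFun.Build _ _ T R _ (@measurable_funPT _ _ _ _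
      (ofTR (repr (x : {mfun_ mu, T >-> measurableTypeR R})))))
    (@isLfunction.Build d T R mu p p1
      (ofTR (repr (x : {mfun_ mu, T >-> measurableTypeR R})))
      (@Lebesgue_finite _ _ _ _ _ _ x)).

Lemma Lspace_eq (x y : L) :
  x = y :> {mfun_ mu, T >-> measurableTypeR R} -> x = y.
Proof.
case: x => x [[xP]]; case: y => y [[yP]]; rewrite [LHS]/= [RHS]/= => xy.
by subst y; rewrite (Prop_irrelevance xP yP).
Qed.

Lemma LclassP (f g : F) : Lclass f = Lclass g <-> f = g %[ae mu].
Proof.
split=> [fg|fg].
- apply: ae_eq_trans (repr_mclsE g).
  rewrite -[mcls g]/(Lclass g : {mfun_ mu, T >-> measurableTypeR R}) -fg.
  exact/ae_eq_sym/repr_mclsE.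
- apply: Lspace_eq; apply/eqP; rewrite eqmodE; exact/asboolP.
Qed.

Lemma LreprK (x : L) : Lclass (Lrepr x) = x.
Proof.
apply: Lspace_eq; rewrite -[RHS]reprK /=; congr (\pi%qT _).
by apply/val_inj.
Qed.

Lemma LclassK (f : F) : Lrepr (Lclass f) = f %[ae mu].
Proof. exact: repr_mclsE. Qed.

Let zero : L := Lclass 0.
Let opp (x : L) : L := Lclass (- Lrepr x).
Let add (x y : L) : L := Lclass (Lrepr x + Lrepr y).
Let scale (a : R) (x : L) : L := Lclass (a *: Lrepr x).

Let cls_opp (f : F) : opp (Lclass f) = Lclass (- f).
Proof.
apply/LclassP; move: (Lrepr (Lclass f)) (LclassK f) => g.
by apply: filterS => x /(_ I) gx _; exact: (congr1 -%R gx).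
Qed.

Let cls_add (f g : F) : add (Lclass f) (Lclass g) = Lclass (f + g).
Proof.
apply/LclassP; move: (Lrepr (Lclass f)) (LclassK f) => f'.
move: (Lrepr (Lclass g)) (LclassK g) => g'.
by apply: filterS2 => x /(_ I) gx /(_ I) fx _; exact: (congr2 +%R fx gx).
Qed.

Let cls_scale a (f : F) : scale a (Lclass f) = Lclass (a *: f).
Proof.
apply/LclassP; move: (Lrepr (Lclass f)) (LclassK f) => g.
by apply: filterS => x /(_ I) gx _; exact: (congr1 ( *%R a) gx).
Qed.

Let addA : associative add.
Proof.
by move=> x y z; rewrite -(LreprK x) -(LreprK y) -(LreprK z) !cls_add addrA.
Qed.

Let addC : commutative add.
Proof. by move=> x y; rewrite -(LreprK x) -(LreprK y) !cls_add addrC. Qed.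

Let add0 : left_id zero add.
Proof. by move=> x; rewrite -(LreprK x) cls_add add0r. Qed.

Let addN : left_inverse zero opp add.
Proof. by move=> x; rewrite -(LreprK x) cls_opp cls_add addNr. Qed.

HB.instance Definition _ := GRing.isZmodule.Build L addA addC add0 addN.

Let scaleA a b (x : L) : scale a (scale b x) = scale (a * b) x.
Proof. by rewrite -(LreprK x) !cls_scale scalerA. Qed.

Let scale1 : left_id 1 scale.
Proof. by move=> x; rewrite -(LreprK x) !cls_scale scale1r. Qed.

Let scaleDr : right_distributive scale +%R.
Proof.
move=> a x y; rewrite -[_ + _]/(add _ _) -[RHS]/(add _ _).
by rewrite -(LreprK x) -(LreprK y) !(cls_scale, cls_add) scalerDr.
Qed.

Let scaleDl (x : L) : {morph scale^~ x : a b / a + b}.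
Proof.
move=> a b; rewrite -[RHS]/(add _ _).
by rewrite -(LreprK x) !(cls_scale, cls_add) scalerDl.
Qed.

HB.instance Definition _ :=
  GRing.Zmodule_isLmodule.Build R L scaleA scale1 scaleDr scaleDl.

Lemma LclassD (f g : F) : Lclass (f + g) = Lclass f + Lclass g.
Proof. by rewrite -[RHS]/(add _ _) cls_add. Qed.

Lemma LclassZ a (f : F) : Lclass (a *: f) = a *: Lclass f.
Proof. by rewrite -[RHS]/(scale _ _) cls_scale. Qed.

Lemma LreprD (x y : L) :
  \forall t \ae mu, (x + y : T -> R) t = (x : T -> R) t + (y : T -> R) t.
Proof.
by apply: filterS (LclassK (Lrepr x + Lrepr y)) => t /(_ I).
Qed.

Lemma LreprZ a (x : L) :
  \forall t \ae mu, (a *: x : T -> R) t = a * (x : T -> R) t.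
Proof.
by apply: filterS (LclassK (a *: Lrepr x)) => t /(_ I).
Qed.

Let nrm (x : L) : R := fine 'N[mu]_p[EFin \o (x : T -> R)].

Let nrm_cls (f : F) : nrm (Lclass f) = fine 'N[mu]_p[EFin \o f].
Proof.
congr fine; apply: (@Lnorm_ae_eq (Lrepr (Lclass f)) f); exact: LclassK.
Qed.

Let nrmD (x y : L) : nrm (x + y) <= nrm x + nrm y.
Proof.
by rewrite -(LreprK x) -(LreprK y) -LclassD !nrm_cls; exact: ler_LnormD.
Qed.

Let nrmZ a (x : L) : nrm (a *: x) = `|a| * nrm x.
Proof.
rewrite -(LreprK x) -LclassZ !nrm_cls; apply/EFin_inj.
rewrite EFinM !finite_norm_fine; exact: LnormZ.
Qed.

Let nrm0 (x : L) : nrm x = 0 -> x = 0.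
Proof.
rewrite -(LreprK x) nrm_cls => /fine_Lnormr_eq0 x0.
exact/LclassP.
Qed.

HB.instance Definition _ := Lmodule_isNormed.Build R L nrmD nrmZ nrm0.

Lemma Lspace_normE (x : L) : `|x| = fine 'N[mu]_p[EFin \o (x : T -> R)].
Proof. by []. Qed.

End LspaceNormed.

Section C01.
Variable R : realType.

Local Notation I01 := (set_type (`[0 : R, 1])).

Definition C01 : Type := continuousType I01 R.
HB.instance Definition _ := Choice.on C01.

Lemma C01_eq (f g : C01) : f =1 g -> f = g.
Proof. by move=> fg; apply/continuousEP. Qed.

Definition C01_of (f : I01 -> R) (cf : continuous f) : C01 :=
  HB.pack f (isContinuous.Build I01 R f cf).

Let zero : C01 := @C01_of (fun=> 0) (@cst_continuous _ _ _).

Let cont_opp (f : C01) : continuous (fun x => - f x : R).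
Proof. by move=> x; exact: (cvgN (@cts_fun _ _ f x)). Qed.

Let cont_add (f g : C01) : continuous (fun x => f x + g x : R).
Proof. by move=> x; exact: (cvgD (@cts_fun _ _ f x) (@cts_fun _ _ g x)). Qed.

Let cont_scale (a : R) (f : C01) : continuous (fun x => a * f x : R).
Proof. by move=> x; exact: (cvgM (@cvg_cst _ _ _ _ _) (@cts_fun _ _ f x)). Qed.

Let opp f := C01_of (@cont_opp f).
Let add f g := C01_of (@cont_add f g).
Let scale a f := C01_of (@cont_scale a f).

Let addA : associative add.
Proof. by move=> f g h; apply: C01_eq => x /=; rewrite addrA. Qed.

Let addC : commutative add.
Proof. by move=> f g; apply: C01_eq => x /=; rewrite addrC. Qed.

Let add0 : left_id zero add.
Proof. by move=> f; apply: C01_eq => x /=; rewrite add0r. Qed.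

Let addN : left_inverse zero opp add.
Proof. by move=> f; apply: C01_eq => x /=; rewrite addNr. Qed.

HB.instance Definition _ := GRing.isZmodule.Build C01 addA addC add0 addN.

Let scaleA a b (f : C01) : scale a (scale b f) = scale (a * b) f.
Proof. by apply: C01_eq => x /=; rewrite mulrA. Qed.

Let scale1 : left_id 1 scale.
Proof. by move=> f; apply: C01_eq => x /=; rewrite mul1r. Qed.

Let scaleDr : right_distributive scale +%R.
Proof. by move=> a f g; apply: C01_eq => x /=; rewrite mulrDr. Qed.

Let scaleDl (f : C01) : {morph scale^~ f : a b / a + b}.
Proof. by move=> a b; apply: C01_eq => x /=; rewrite mulrDl. Qed.

HB.instance Definition _ :=
  GRing.Zmodule_isLmodule.Build R C01 scaleA scale1 scaleDr scaleDl.

Definition sup_norm (f : C01) : R := sup (range (fun x : I01 => `|f x|)).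

Let I010_subproof : (0 : R) \in (`[0 : R, 1]%classic).
Proof. by rewrite inE /= in_itv /= lexx ler01. Qed.

Let I010 : I01 := exist _ 0 I010_subproof.

Lemma C01_bounded (f : C01) : has_ubound (range (fun x : I01 => `|f x|)).
Proof.
have /subspace_valL_continuousP cf := @cts_fun _ _ f.
have := continuous_compact cf (@segment_compact _ 0 1).
move=> /compact_bounded [M [_ /(_ (M + 1))]].
rewrite ltrDl ltr01 => /(_ isT) fM.
exists (M + 1) => _ [x _ <-]; apply: fM; exists (set_val x).
  exact: set_valP.
exact: (congr1 (fun g => g x) (valLK point (f : _ -> _))).
Qed.

Lemma le_sup_norm (f : C01) (x : I01) : `|f x| <= sup_norm f.
Proof. by apply: ub_le_sup; [exact: C01_bounded|exists x]. Qed.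

Lemma sup_norm_le (f : C01) (M : R) :
  (forall x, `|f x| <= M) -> sup_norm f <= M.
Proof.
by move=> fM; apply: ge_sup => [|_ [x _ <-]//]; exists `|f I010|, I010.
Qed.

Let nrmD (f g : C01) : sup_norm (f + g) <= sup_norm f + sup_norm g.
Proof.
apply: sup_norm_le => x; apply: (le_trans (ler_normD _ _)).
by apply: lerD; exact: le_sup_norm.
Qed.

Let nrmZ_le (a : R) (f : C01) : sup_norm (a *: f) <= `|a| * sup_norm f.
Proof.
by apply: sup_norm_le => x; rewrite /= normrM ler_wpM2l ?le_sup_norm.
Qed.

Let nrmZ (a : R) (f : C01) : sup_norm (a *: f) = `|a| * sup_norm f.
Proof.
apply/eqP; rewrite eq_le nrmZ_le/=; have [->|a0] := eqVneq a 0.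
  by rewrite normr0 mul0r (le_trans _ (le_sup_norm _ I010)).
rewrite -ler_pdivlMl ?normr_gt0// -normfV.
by rewrite -{1}(scalerK a0 f) nrmZ_le.
Qed.

Let nrm0 (f : C01) : sup_norm f = 0 -> f = 0.
Proof.
move=> f0; apply: C01_eq => x; apply/eqP.
by rewrite -normr_le0; apply: (le_trans (le_sup_norm f x)); rewrite f0.
Qed.

HB.instance Definition _ := Lmodule_isNormed.Build R C01 nrmD nrmZ nrm0.

End C01.

Section Volterra.
Variable R : realType.
Local Notation leb := (@lebesgue_measure R).

Definition leb01 := mrestr leb (measurable_itv `[0 : R, 1]).
HB.instance Definition _ := Measure.on leb01.

(* [leb01] identifies functions that agree almost everywhere on [0, 1] and
   ignores values elsewhere, so this space is L^1([0, 1]). *)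
Definition L1_01 : Type := LspaceType leb01 (lexx 1%E).
HB.instance Definition _ := NormedModule.on L1_01.

Lemma integral_leb01 (D : set R) (f : R -> \bar R) :
  D `<=` `[0, 1] -> (\int[leb01]_(x in D) f x = \int[leb]_(x in D) f x)%E.
Proof.
move=> D01; apply: eq_measure_integral => A mA AD.
by rewrite /= /leb01 /mrestr setIidl//; exact: subset_trans D01.
Qed.

Lemma ae_leb01 (P : set R) :
  (\forall t \ae leb01, P t) -> (\forall t \ae leb, t \in `[0, 1] -> P t).
Proof.
move=> [N [mN N0 PN]]; exists (N `&` `[0, 1]); split => //.
  exact: measurableI.
move=> t /= /not_implyP [t01 Pt]; split => //; exact: PN.
Qed.

Lemma L1_01_integrable (f : L1_01) :
  leb.-integrable `[0, 1] (EFin \o (f : R -> R)).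
Proof.
have /Lfun1_integrable fT := LfunP (Lrepr f).
have : leb01.-integrable `[0, 1] (EFin \o (f : R -> R)).
  by apply: integrableS fT => //; exact: measurable_itv.
move=> /integrableP [mf fi]; apply/integrableP; split => //.
by rewrite -integral_leb01.
Qed.

Lemma L1_01_norm (f : L1_01) :
  `|f| = \int[leb]_(t in `[0, 1]) `|(f : R -> R) t|.
Proof.
rewrite Lspace_normE Lnorm1 /Rintegral -integral_leb01//; congr fine.
have /Lfun1_integrable/integrableP [mf _] := LfunP (Lrepr f).
have mfa : measurable_fun setT (abse \o (EFin \o Lrepr f)).
  exact: measurableT_comp.
rewrite [RHS]integral_mkcond; apply: ae_eq_integral => //=.
- apply/(measurable_restrictT _ _).1; first exact: measurable_itv.
  exact: measurable_funTS mfa.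
- exists (~` `[0, 1]); split; first exact: measurableC.
    by rewrite /= /leb01 /mrestr setICl measure0.
  move=> t /= /not_implyP [_ ft] t01; apply: ft.
  by rewrite patchE mem_set.
Qed.

Definition volterra_fun (f : L1_01) (x : set_type (`[0 : R, 1])) : R :=
  \int[leb]_(t in `[0, set_val x]) (f : R -> R) t.

Lemma volterra_continuous (f : L1_01) : continuous (volterra_fun f).
Proof.
have := parameterized_integral_continuous ler01 (L1_01_integrable f).
by move=> /subspace_sigL_continuousP.
Qed.

Definition volterra_op (f : L1_01) : C01 R := C01_of (@volterra_continuous f).

Let sub01 (x : set_type (`[0 : R, 1])) : `[0, set_val x] `<=` `[0 : R, 1].
Proof.
apply: subset_itvl; rewrite bnd_simp.
by have := set_valP x; rewrite /= in_itv /= => /andP[].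
Qed.

Let int01 (f : L1_01) (x : set_type (`[0 : R, 1])) :
  leb.-integrable `[0, set_val x] (EFin \o (f : R -> R)).
Proof. by apply: integrableS (L1_01_integrable f) => //; exact: sub01. Qed.

Lemma volterra_linear : linear volterra_op.
Proof.
move=> a f g; apply: C01_eq => x.
have mI : measurable (`[0, set_val x] : set (measurableTypeR R)).
  exact: measurable_itv.
have intaf : leb.-integrable `[0, set_val x]
    (EFin \o (fun t => a * (f : R -> R) t)).
  have := integrableZl mI a (int01 f x).
  by apply: eq_integrable => // t _; rewrite /= EFinM.
have intafg : leb.-integrable `[0, set_val x]
    (EFin \o (fun t => a * (f : R -> R) t + (g : R -> R) t)).
  have := integrableD mI intaf (int01 g x).
  by apply: eq_integrable => // t _; rewrite /= EFinD.
rewrite [LHS]/= [RHS]/= /volterra_fun -RintegralZl// -RintegralD//.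
congr fine; apply: ae_eq_integral => //.
- exact: measurable_int (int01 _ x).
- exact: measurable_int intafg.
have afg := ae_leb01 (LreprD (a *: f) g).
have af := ae_leb01 (LreprZ a f).
apply: (@filterS2 _ _ (ae_filter_ringOfSetsType leb) _ _ _ _ af afg).
move=> t {}af {}afg /sub01 t01.
by rewrite /= afg ?af.
Qed.

HB.instance Definition _ :=
  GRing.isLinear.Build R L1_01 (C01 R) *:%R volterra_op volterra_linear.

Definition volterra : {linear L1_01 -> C01 R} := volterra_op.

Lemma volterraE (f : L1_01) (x : set_type (`[0 : R, 1])) :
  volterra f x = \int[leb]_(t in `[0, set_val x]) (f : R -> R) t.
Proof. by []. Qed.

Lemma volterra_norm_le (f : L1_01) : `|volterra f| <= `|f|.
Proof.
apply: sup_norm_le => x; rewrite volterraE L1_01_norm.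
have mI : measurable (`[0, set_val x] : set (measurableTypeR R)).
  exact: measurable_itv.
apply: (le_trans (le_normr_Rintegral mI (int01 f x))).
have inta : leb.-integrable `[0, 1] (EFin \o (fun t => `|(f : R -> R) t|)).
  have := integrable_abse (L1_01_integrable f).
  by apply: eq_integrable => //; exact: measurable_itv.
have mJ : measurable (`[0, 1] : set (measurableTypeR R)).
  exact: measurable_itv.
rewrite /Rintegral fine_le//.
- by apply: integrable_fin_num => //; exact: integrableS inta.
- exact: integrable_fin_num.
- by apply: ge0_subset_integral => //; exact: measurable_int inta.
Qed.

(* [opnorm] of [volterra], and of its differences with bounded operators, is
   therefore the supremum of a bounded set. *)
Lemma volterra_bounded : continuous volterra.
Proof.
apply/bounded_linear_continuous/linear_boundedP.
apply: filterS (nbhs_pinfty_ge (num_real (1 : R))) => r r1 f.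
by apply: (le_trans (volterra_norm_le f)); rewrite ler_peMl.
Qed.

End Volterra.

(* Main.v *)
From HB Require Import structures.
Require Import Defs.
From mathcomp Require Import all_boot all_order all_algebra.
From mathcomp Require Import all_classical all_reals all_analysis.
From mathcomp Require Import measurable_realfun.
Import Order.TTheory GRing.Theory Num.Theory.
Import numFieldNormedType.Exports.
Local Open Scope classical_set_scope.
Local Open Scope ring_scope.

(** Both essential norms are at most 1/2 because half the mean value,
    K f = (1/2) \int_0^1 f seen as a constant function, is a rank-one operator
    and
    V f (x) - K f = (1/2) (\int_0^x f - \int_x^1 f),
    whose modulus is at most half of the L^1 norm of f
    ([half_mean_compact], [volterra_half_mean_le]).

    Conversely, no weakly compact S is closer to V than 1/2
    ([volterra_weakly_compact_ge]): V sends a sequence concentrating at 0 to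
    functions that converge pointwise to a jump, and a jump of height 1 stays
    at distance 1/2 from every continuous function. In detail, let
    f_n = (n + 1) 1_[0, 1/(n+1)]. These are unit vectors of L^1, V f_n (0) = 0,
    and V f_n (x) = 1 as soon as 1/(n+1) <= x. The sequence S f_n has a weak
    cluster point g in C([0, 1]). Point evaluations are weakly continuous, so
    the bound |V f_n (x) - S f_n (x)| <= c, with c the norm of V - S, yields
    |g(0)| <= c and |1 - g(x)| <= c for x > 0. By continuity of g at 0,
    1 <= 2 c.

    A compact operator into C([0, 1]) is weakly compact
    ([compact_operator_weakly]), so the lower bound applies to both essential
    norms; the upper bound is attained at K in both cases. *)

(** * Operator norms *)

Section OperatorNorm.
Context {R : realType} {X Y : normedModType R}.
Implicit Types A B : {linear X -> Y}.

Lemma opnorm_le (T : X -> Y) (M : R) :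
  (forall x, `|x| <= 1 -> `|T x| <= M) -> opnorm T <= M.
Proof.
move=> TM; apply: ge_sup => [|_ [x /= x1 <-]]; last exact: TM.
by exists `|T 0|; exists 0 => //; rewrite /unit_ball /= normr0 ler01.
Qed.

Lemma le_opnormB A B (x : X) : continuous A -> continuous B -> `|x| <= 1 ->
  `|A x - B x| <= opnorm (A \- B).
Proof.
move=> cA cB x1; apply: ub_le_sup; last by exists x.
have bounded (C : {linear X -> Y}) :
    continuous C -> exists M, forall y, `|y| <= 1 -> `|C y| <= M.
  move=> cC; have /linear_bounded_continuous/bounded_funP := cC.
  exact.
have [M AM] := bounded _ cA; have [N BN] := bounded _ cB.
exists (M + N) => _ [y y1 <-].
by rewrite /= (le_trans (ler_normB _ _))// lerD// ?AM ?BN.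
Qed.

End OperatorNorm.

(** * The weak topology *)

Section WeakTopology.
Context {R : realType} {Y : normedModType R}.

Lemma weak_topology_continuous (phi : {linear Y -> R^o}) :
  continuous phi -> continuous (phi : weak_topology Y -> R^o).
Proof.
move=> cphi y.
pose i : {phi : {linear Y -> R^o} | continuous phi} := exist _ phi cphi.
have /cvg_sup/(_ i) ny : nbhs (y : weak_topology Y) --> (y : weak_topology Y).
  by [].
move=> A /(@initial_continuous _ _ (phi : Y -> R^o)) Ay.
exact: (ny _ Ay).
Qed.

Lemma norm_to_weak_continuous : continuous (id : Y -> weak_topology Y).
Proof.
move=> y; apply/cvg_sup => -[phi cphi] /=.
pose T := initial_topology (phi : Y -> R^o).
have : continuous (id : Y -> T) by exact: continuous_comp_initial.
exact.
Qed.

Lemma weak_topology_hausdorff :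
  (forall y : Y,
    (forall phi : {linear Y -> R^o}, continuous phi -> phi y = 0) -> y = 0) ->
  hausdorff_space (weak_topology Y).
Proof.
move=> sep p q pq; apply/eqP; rewrite -subr_eq0; apply/eqP.
apply: (sep (p - q : Y)) => phi cphi; rewrite linearB; apply/eqP.
rewrite subr_eq0; apply/eqP; apply: (@norm_hausdorff _ R^o) => A B pA qB.
have wphi := weak_topology_continuous phi cphi.
have [y [Ay By]] := pq _ _ (wphi _ _ pA) (wphi _ _ qB).
by exists (phi y).
Qed.

(** A norm-compact set is weakly compact; the Hausdorff hypothesis makes it
    weakly closed as well, as relative compactness asks for a closed compact
    superset. *)
Lemma compact_operator_weakly (X : normedModType R) (S : {linear X -> Y}) :
  hausdorff_space (weak_topology Y) ->
  compact_operator S -> weakly_compact_operator S.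
Proof.
move=> hY [cS [K SK [Kc _]]]; split => //.
have wK : compact (K : set (weak_topology Y)).
  rewrite -[K]image_id.
  apply: (@continuous_compact Y (weak_topology Y) id K) => //.
  exact/continuous_subspaceT/norm_to_weak_continuous.
by exists K => //; split => //; exact: compact_closed.
Qed.

End WeakTopology.

(** * Point evaluations on C([0, 1]) *)

Section Evaluation.
Context {R : realType}.
Local Notation I01 := (set_type (`[0 : R, 1])).

(** A named constant for f |-> f x, so that the linear structure below can be
    attached to it. *)
Definition eval_at (x : I01) (f : C01 R) : R^o := f x.

Fact eval_at_linear (x : I01) : linear (eval_at x).
Proof. by []. Qed.

HB.instance Definition _ (x : I01) :=
  GRing.isLinear.Build R (C01 R) R^o *:%R (eval_at x) (eval_at_linear x).

Lemma eval_at_continuous (x : I01) : continuous (eval_at x).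
Proof.
apply/bounded_linear_continuous/linear_boundedP.
apply: filterS (nbhs_pinfty_ge (num_real (1 : R))) => r r1 f.
apply: (le_trans (le_sup_norm f x)).
by apply: ler_peMl r1; exact: (normr_ge0 f).
Qed.

Lemma C01_weak_hausdorff : hausdorff_space (weak_topology (C01 R)).
Proof.
apply: weak_topology_hausdorff => f f0; apply: C01_eq => x.
exact: (f0 (eval_at x) (eval_at_continuous x)).
Qed.

Lemma ex_I01 (t : R) : 0 <= t <= 1 -> exists x : I01, set_val x = t.
Proof.
move=> t01; have tI : t \in (`[0, 1]%classic : set R) by rewrite inE /= in_itv.
by exists (exist _ t tI).
Qed.

(** [0, 1] accumulates at 0 from the right: this is how the jump of the limit
    of V f_n is transferred to a continuous function. *)
Lemma C01_right_cvg0 (f : C01 R) (x0 : I01) (e : R) : set_val x0 = 0 ->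
  0 < e -> exists2 x : I01, 0 < set_val x & `|f x0 - f x| < e.
Proof.
move=> x00 e0; have /cvgrPdist_lt/(_ _ e0) := @cts_fun _ _ f x0.
move=> fx0.
have [/= V [[B oB BV] Vx0] Vf] :
    nbhs (x0 : initial_topology set_val) [set t | `|f x0 - f t| < e] by [].
move: Vx0; rewrite -BV /= x00 => B0.
have /nbhs_ballP[d /= d0 dB] : nbhs (0 : R) B by exact: open_nbhs_nbhs.
have m0 : 0 < Num.min (d / 2) 1 by rewrite lt_min ltr01 divr_gt0.
have [|x xE] := ex_I01 (Num.min (d / 2) 1).
  by rewrite (ltW m0) ge_min lexx orbT.
exists x; first by rewrite xE.
apply: Vf; rewrite -BV; apply: dB; rewrite xE /ball /= sub0r normrN gtr0_norm//.
by rewrite gt_min ltr_pdivrMr// ltr_pMr// ltr1n.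
Qed.

End Evaluation.

(** * Unit vectors of L^1 concentrating at 0 *)

Section Spike.
Context {R : realType}.
Local Notation leb := (@lebesgue_measure R).
Local Notation I01 := (set_type (`[0 : R, 1])).

Definition spike_fun (e t : R) : R := e^-1 * \1_(`[0, e]) t.

Let measurable_spike_fun (e : R) (D : set R) : measurable_fun D (spike_fun e).
Proof.
apply: measurable_funM; first exact: measurable_cst.
by apply: measurable_indic.
Qed.

Lemma integral_spike_fun (e x : R) : 0 < e <= x ->
  (\int[leb]_(t in `[0%R, x]) (spike_fun e t)%:E = 1)%E.
Proof.
move=> /andP[e0 ex]; rewrite /spike_fun.
under eq_integral do rewrite EFinM.
rewrite ge0_integralZl//; first last.
- by rewrite lee_fin invr_ge0 ltW.
- by apply/measurable_EFinP; apply: measurable_indic.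
rewrite integral_indic// setIidl; last first.
  by apply: subset_itvl; rewrite bnd_simp.
have lebe : leb `[0, e] = e%:E.
  by rewrite lebesgue_measure_itv/= lte_fin e0 oppr0 adde0.
transitivity ((e^-1)%:E * e%:E)%E; first by congr (_ * _)%E.
by rewrite -EFinM mulVf// gt_eqF.
Qed.

Lemma spike_fun_ge0 (e t : R) : 0 < e -> 0 <= spike_fun e t.
Proof. by move=> e0; rewrite mulr_ge0// invr_ge0 ltW. Qed.

Lemma spike_fun_Lfun (e : R) : 0 < e ->
  spike_fun e \in Lfun (@leb01 R) 1%E.
Proof.
move=> e0; apply/Lfun1_integrable/measurable_bounded_integrable => //.
(* The total mass of [leb01] is the Lebesgue measure of [0, 1]. *)
- change (leb (setT `&` `[0%R, 1%R]) < +oo)%E; rewrite setTI.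
  by rewrite lebesgue_measure_itv/= lte_fin ltr01 oppr0 adde0 ltry.
- exact: measurable_spike_fun.
- apply/ex_bound; first exact: (globally_properfilter (a := 0)).
  exists e^-1 => t _ /=; rewrite ger0_norm ?spike_fun_ge0//.
  rewrite /spike_fun indicE; apply: ler_piMr; first by rewrite invr_ge0 ltW.
  by case: (_ \in _); rewrite ?ler01.
Qed.

(** Take the class of [spike_fun e]: its representative agrees with [spike_fun e]
    only almost everywhere on [0, 1], but integrals see no difference. *)
Lemma ex_spike (e : R) : 0 < e <= 1 ->
  exists2 f : L1_01 R, `|f| <= 1 &
    forall x : I01, e <= set_val x -> volterra R f x = 1.
Proof.
move=> e01; have /andP[e0 e1] := e01.
pose F := @Lfun_Sub _ _ R _ _ (lexx 1%E) _ (spike_fun_Lfun e e0).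
pose f : L1_01 R := Lclass F.
have fE : ae_eq leb (`[0 : R, 1]%classic) (EFin \o (f : R -> R))
    (EFin \o spike_fun e).
  have /ae_leb01 := LclassK F.
  apply: (@filterS _ _ (ae_filter_ringOfSetsType leb)) => t ft t01.
  by congr EFin; apply: ft => //; rewrite inE.
have m01 : measurable_fun (`[0, 1] : set R) (EFin \o (f : R -> R)).
  exact: measurable_int (L1_01_integrable f).
have x01 x : x <= 1 -> `[0, x] `<=` `[0 : R, 1].
  by move=> x1; apply: subset_itvl; rewrite bnd_simp.
have intf (x : R) : e <= x <= 1 ->
    (\int[leb]_(t in `[0%R, x]) ((f : R -> R) t)%:E = 1)%E.
  move=> /andP[ex x1].
  apply: etrans (integral_spike_fun e x _); last by rewrite e0.
  apply: ae_eq_integral => //.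
  - exact: measurable_funS (x01 _ x1) m01.
  - by apply/measurable_EFinP; exact: measurable_spike_fun.
  - move: fE; apply: (@filterS _ _ (ae_filter_ringOfSetsType leb)) => t ft.
    by move=> /(x01 _ x1); exact: ft.
exists f.
- rewrite L1_01_norm /Rintegral; set I := (X in fine X).
  suff -> : I = 1%E by [].
  apply: etrans (integral_spike_fun e 1 e01); apply: ae_eq_integral => //.
  + apply/measurable_EFinP/measurableT_comp => //.
    exact/measurable_EFinP.
  + by apply/measurable_EFinP; exact: measurable_spike_fun.
  + apply: ae_eq_trans (ae_eq_abse fE) _; apply: aeW => t _ /=.
    by rewrite ger0_norm// spike_fun_ge0.
- move=> x ex; rewrite volterraE /Rintegral intf//.
  by rewrite ex; have := set_valP x; rewrite /= in_itv/= => /andP[].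
Qed.

Lemma volterra0 (f : L1_01 R) (x : I01) : set_val x = 0 -> volterra R f x = 0.
Proof. by rewrite volterraE => ->; rewrite set_itv1 Rintegral_set1. Qed.

End Spike.

(** * The lower bound *)

Section LowerBound.
Context {R : realType}.
Local Notation I01 := (set_type (`[0 : R, 1])).

(** Closed balls of R pass to weak cluster points through the evaluation at x,
    which is weakly continuous. *)
Lemma cluster_eval_le (u : nat -> C01 R) (g : weak_topology (C01 R))
    (x : I01) (a c : R) :
  cluster ((u : nat -> weak_topology (C01 R)) @ \oo) g ->
  (\forall n \near \oo, `|a - u n x| <= c) -> `|a - (g : C01 R) x| <= c.
Proof.
move=> gu ux; have cx := weak_topology_continuous _ (eval_at_continuous x).
apply/ler_addgt0Pr => e e0.
have /cvgrPdist_lt/(_ _ e0) ge := cx g.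
have [y /= [ay gy]] := gu [set h | `|a - (h : C01 R) x| <= c] _ ux ge.
rewrite -(subrKA (eval_at x y)) (le_trans (ler_normD _ _))// lerD//.
by rewrite distrC; exact: ltW.
Qed.

Lemma volterra_weakly_compact_ge (S : {linear L1_01 R -> C01 R}) :
  weakly_compact_operator S -> 1 / 2 <= opnorm (volterra R \- S).
Proof.
move=> [cS [U SU [Uc _]]]; set c := opnorm _.
have /choice[f fP] (n : nat) : exists f : L1_01 R, `|f| <= 1 /\
    forall x : I01, n.+1%:R^-1 <= set_val x -> volterra R f x = 1.
  have [|f f1 fx] := ex_spike (R := R) n.+1%:R^-1; last by exists f.
  by rewrite invr_gt0 ltr0n/= invf_le1 ?ler1n ?ltr0n.
have Sf n x : `|volterra R (f n) x - S (f n) x| <= c.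
  apply: le_trans (le_opnormB _ _ _ (@volterra_bounded R) cS (fP n).1).
  exact: (le_sup_norm (volterra R (f n) - S (f n)) x).
have SfU : ((S \o f : nat -> weak_topology (C01 R)) @ \oo) U.
  by exists 0 => // n _; apply: SU; exists (f n) => //; exact: (fP n).1.
have [g [_ gS]] := Uc _ (fmap_proper_filter _ eventually_filter) SfU.
have [|x0 x00] := ex_I01 (0 : R); first by rewrite lexx ler01.
have g0 : `|0 - (g : C01 R) x0| <= c.
  apply: (cluster_eval_le _ _ _ _ _ gS); apply: nearW => n.
  by have := Sf n x0; rewrite volterra0.
have g1 (x : I01) : 0 < set_val x -> `|1 - (g : C01 R) x| <= c.
  move=> x_gt0; apply: (cluster_eval_le _ _ _ _ _ gS).
  (* Once 1/(n+1) is below x, V f_n takes the value 1 at x. *)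
  have := near_infty_natSinv_lt (PosNum x_gt0).
  by apply: filterS => n /= /ltW xn; have := Sf n x; rewrite (fP n).2.
rewrite ler_pdivrMr// mulr_natr mulr2n; apply/ler_addgt0Pr => e e0.
have [x x_gt0 gx] := C01_right_cvg0 (g : C01 R) x0 e x00 e0.
(* The jump at 0 splits into the two errors and the oscillation of [g]. *)
have -> : 1 = `|(1 - (g : C01 R) x) - (0 - (g : C01 R) x0)
    - ((g : C01 R) x0 - (g : C01 R) x)| :> R.
  by rewrite sub0r opprK opprB addrACA subrK subrr addr0 normr1.
apply: (le_trans (ler_normB _ _)); apply: lerD; last exact: ltW.
by apply: (le_trans (ler_normB _ _)); apply: lerD; [exact: g1|exact: g0].
Qed.

End LowerBound.

(** * The upper bound *)

Section HalfMean.
Context {R : realType}.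
Local Notation leb := (@lebesgue_measure R).
Local Notation I01 := (set_type (`[0 : R, 1])).

Definition cst01 (a : R) : C01 R := C01_of (@cst_continuous I01 R a).

Lemma cst01_continuous : continuous cst01.
Proof.
move=> a; apply/cvgrPdist_le => e e0.
apply: filterS (nbhsx_ballx a e e0) => b ab.
by apply: sup_norm_le => x; exact: ltW.
Qed.

Definition half_mean (f : L1_01 R) : C01 R :=
  cst01 ((\int[leb]_(t in `[0, 1]) (f : R -> R) t) / 2).

Lemma half_mean_linear : linear half_mean.
Proof.
(* Linearity is inherited from V, since the integral over [0, 1] is V at 1. *)
have [|x1 x11] := ex_I01 (1 : R); first by rewrite lexx ler01.
move=> a f g; apply: C01_eq => x.
have h (k : L1_01 R) : half_mean k x = volterra R k x1 / 2.
  by rewrite volterraE x11.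
change (half_mean (a *: f + g) x = a * half_mean f x + half_mean g x).
by rewrite !h linearP/= mulrDl mulrA.
Qed.

HB.instance Definition _ :=
  GRing.isLinear.Build R (L1_01 R) (C01 R) *:%R half_mean half_mean_linear.

Lemma norm_integral_le (f : L1_01 R) :
  `|\int[leb]_(t in `[0, 1]) (f : R -> R) t| <= `|f|.
Proof.
by rewrite L1_01_norm; apply: le_normr_Rintegral (L1_01_integrable f).
Qed.

Lemma half_mean_norm_le (f : L1_01 R) : `|half_mean f| <= `|f| / 2.
Proof.
apply: sup_norm_le => x; rewrite /= normrM normfV (ger0_norm (ler0n _ 2)).
by rewrite ler_wpM2r ?invr_ge0 ?ler0n ?norm_integral_le.
Qed.

Lemma half_mean_compact : compact_operator half_mean.
Proof.
split.
  apply/bounded_linear_continuous/linear_boundedP.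
  apply: filterS (nbhs_pinfty_ge (num_real (2^-1 : R))) => r r1 f.
  apply: le_trans (half_mean_norm_le f) _.
  by rewrite mulrC ler_wpM2r ?normr_ge0.
have cK : compact (cst01 @` `[-1, 1]).
  apply: continuous_compact; last exact: segment_compact.
  exact/continuous_subspaceT/cst01_continuous.
(* The values of [half_mean] on the ball lie in [-1/2, 1/2]; any compact
   interval of constants containing them will do. *)
exists (cst01 @` `[-1, 1]); last first.
  by split => //; apply: compact_closed => //; exact: norm_hausdorff.
move=> _ [f f1 <-]; eexists; last by [].
rewrite /= in_itv/= -ler_norml normrM normfV (ger0_norm (ler0n _ 2)).
rewrite ler_pdivrMr// mul1r.
by rewrite (le_trans (norm_integral_le f))// (le_trans f1)// ler1n.
Qed.

Lemma volterra_half_mean_le : opnorm (volterra R \- half_mean) <= 1 / 2.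
Proof.
apply: opnorm_le => f f1; apply: sup_norm_le => x.
set y := set_val x.
have /andP[y0 y1] : 0 <= y <= 1 by have := set_valP x; rewrite /= in_itv.
have intf := L1_01_integrable f.
have intN : leb.-integrable `[0, 1] (EFin \o (fun t => `|(f : R -> R) t|)).
  exact: integrable_abse intf.
have split01 (h : R -> R) : leb.-integrable `[0, 1] (EFin \o h) ->
    \int[leb]_(t in `[0, 1]) h t =
    \int[leb]_(t in `[0, y]) h t + \int[leb]_(t in `]y, 1]) h t.
  by move=> hi; rewrite -(Rintegral_itvB hi) ?bnd_simp// addrC subrK.
have int_le (D : set R) : measurable D -> D `<=` `[0, 1] ->
    `|\int[leb]_(t in D) (f : R -> R) t| <=
    \int[leb]_(t in D) `|(f : R -> R) t|.
  by move=> mD D01; apply: le_normr_Rintegral => //; exact: integrableS intf.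
change (`|\int[leb]_(t in `[0, y]) (f : R -> R) t
  - \int[leb]_(t in `[0, 1]) (f : R -> R) t / 2| <= 1 / 2).
rewrite (split01 _ intf); set A := Rintegral _ _ _; set B := Rintegral _ _ _.
(* Subtracting half the mean balances the two sides of x. *)
have -> : A - (A + B) / 2 = (A - B) / 2.
  by rewrite {1}(splitr A) !mulrDl mulNr opprD addrA addrK.
rewrite normrM normfV (ger0_norm (ler0n _ 2)) ler_wpM2r ?invr_ge0 ?ler0n//.
apply: le_trans f1; rewrite L1_01_norm (split01 _ intN).
apply: (le_trans (ler_normB _ _)); apply: lerD; apply: int_le => //.
- by apply: subset_itvl; rewrite bnd_simp.
- by apply: subset_itvr; rewrite bnd_simp.
Qed.

End HalfMean.

(** * The essential norms *)

Theorem theorem4p1 (R : realType) :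
  ess_norm (volterra R) = 1 / 2 /\ weak_ess_norm (volterra R) = 1 / 2.
Proof.
have C_W (S : {linear L1_01 R -> C01 R}) :
    compact_operator S -> weakly_compact_operator S.
  exact: (compact_operator_weakly _ _ C01_weak_hausdorff).
(* Both norms are infima over a class of operators that contains [half_mean]
   and consists of weakly compact operators. *)
have inf_half (P : {linear L1_01 R -> C01 R} -> Prop) :
    (forall S, P S -> weakly_compact_operator S) -> P half_mean ->
    inf [set opnorm (volterra R \- S) | S in P] = 1 / 2.
  move=> PW Ph.
  have lb : lbound [set opnorm (volterra R \- S) | S in P] (1 / 2).
    by move=> _ [S PS <-]; exact/volterra_weakly_compact_ge/PW.
  apply/le_anti/andP; split; last first.
    by apply: lb_le_inf lb; exists (opnorm (volterra R \- half_mean)), half_mean.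
  apply: le_trans volterra_half_mean_le.
  by apply: ge_inf; [exists (1 / 2)|exists half_mean].
split; apply: inf_half => //; first exact: half_mean_compact.
exact/C_W/half_mean_compact.
Qed.
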